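(* Let $\ell \ge r \ge 2$ be integers, let $\delta > 0$, and put $\epsilon = (r-2)!\,\delta$. Then there exists $n_0$ such that the following holds for all $n \ge n_0$. Let $G$ be an $n$-vertex $\mathcal{K}_{\ell+1}^{(r)}$-free $r$-graph with at least $(1-\epsilon)\,t_r(n,\ell)$ edges. Then the vertex set of $G$ has a partition $V_1 \cup \dots \cup V_\ell$ such that all but at most $\delta n^r$ edges of $G$ have at most one vertex in each $V_i$.
   Context: An $r$-graph is an $r$-uniform hypergraph: a vertex set together with a set of $r$-element subsets of it, called edges. $\mathcal{K}_{\ell+1}^{(r)}$ is the family of all $r$-graphs $F$ with at most $\binom{\ell+1}{2}$ edges such that for some $(\ell+1)$-set $S$ of vertices, every pair $x,y \in S$ of distinct vertices is contained in an edge of $F$. An $r$-graph is $\mathcal{F}$-free, for a family $\mathcal{F}$ of $r$-graphs, if it contains no member of $\mathcal{F}$ as a subgraph (not necessarily induced). Given a partition $U_1 \cup \dots \cup U_\ell$ of $[n]=\{1,\dots,n\}$ with each part of size $\lfloor n/\ell\rfloor$ or $\lceil n/\ell\rceil$, $T_r(n,\ell)$ is the $r$-graph of all $r$-subsets of $[n]$ that meet each $U_i$ in at most one vertex, and $t_r(n,\ell)$ is its number of edges. Parts of the partition $V_1\cup\dots\cup V_\ell$ in the claim are allowed to be empty. *)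

(* Defs.v *)
From mathcomp Require Import all_boot.
From mathcomp Require Import zify.

Set Implicit Arguments.
Unset Strict Implicit.
Unset Printing Implicit Defensive.

Record hgraph (r : nat) (T : finType) := HGraph {
  edges :> {set {set T}};
  edges_uniform : forall e : {set T}, e \in edges -> #|e| = r }.

(* F is isomorphic to a (not necessarily induced) subgraph of G. *)
Definition contains_copy (r : nat) (U T : finType)
    (F : hgraph r U) (G : hgraph r T) : Prop :=
  exists2 f : U -> T, injective f & forall e : {set U}, e \in F -> f @: e \in G.

Definition hgraph_family (r : nat) := forall U : finType, hgraph r U -> Prop.

Definition family_free (r : nat) (Fam : hgraph_family r) (T : finType)
    (G : hgraph r T) : Prop :=
  forall (U : finType) (F : hgraph r U), Fam U F -> ~ contains_copy F G.

(* The family K_k^(r); the theorem uses it with k = l + 1. *)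
Definition Kfamily (r k : nat) : hgraph_family r :=
  fun (U : finType) (F : hgraph r U) =>
    #|edges F| <= 'C(k, 2) /\
    exists2 S : {set U}, #|S| = k &
      forall x y : U, x \in S -> y \in S -> x != y ->
        exists2 e : {set U}, e \in F & (x \in e) && (y \in e).
Arguments Kfamily : clear implicits.

(* A partition into l labelled parts, some of which may be empty (unlike the
   blocks of finset's [partition]). *)
Definition parts_of (l : nat) (T : finType) (V : 'I_l -> {set T}) : Prop :=
  \bigcup_(i < l) V i = [set: T] /\
  forall i j : 'I_l, i != j -> [disjoint V i & V j].

Definition transversal_edge (l : nat) (T : finType) (V : 'I_l -> {set T})
    (e : {set T}) : bool :=
  [forall i : 'I_l, #|e :&: V i| <= 1].

Definition turan_edges (r l : nat) (T : finType) (V : 'I_l -> {set T}) :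
    {set {set T}} :=
  [set e : {set T} | (#|e| == r) && transversal_edge V e].

Lemma turan_uniform (r l : nat) (T : finType) (V : 'I_l -> {set T})
    (e : {set T}) : e \in turan_edges r V -> #|e| = r.
Proof. by rewrite inE => /andP[/eqP]. Qed.

Definition turan_on (r l : nat) (T : finType) (V : 'I_l -> {set T}) :
    hgraph r T := HGraph (@turan_uniform r l T V).

(* Balanced partitions of [n] into l parts differ only by a relabelling of the
   vertices and of the parts, so T_r(n, l) is built on the residue classes
   modulo l; [residue_parts_partition] and [residue_parts_balanced] check that
   they form such a partition. *)
Definition residue_parts (n l : nat) (i : 'I_l) : {set 'I_n} :=
  [set x : 'I_n | x %% l == i].

Definition turan_graph (r n l : nat) : hgraph r 'I_n :=
  turan_on r (@residue_parts n l).

Definition turan_number (r n l : nat) : nat := #|edges (turan_graph r n l)|.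

Lemma residue_parts_partition (n l : nat) :
  0 < l -> parts_of (@residue_parts n l).
Proof.
move=> l0; split.
  apply/setP => x; rewrite inE; apply/bigcupP.
  by exists (Ordinal (ltn_pmod x l0)) => //; rewrite inE.
move=> i j ij; rewrite -setI_eq0; apply/eqP/setP => x; rewrite !inE.
apply/negP => /andP[/eqP xi /eqP xj].
by case/negP: ij; apply/eqP/val_inj; rewrite /= -xi.
Qed.

Lemma residue_parts_balanced (n l : nat) (i : 'I_l) :
  #|residue_parts n i| = n %/ l \/
  #|residue_parts n i| = (n + l.-1) %/ l.
Proof.
have l0 : 0 < l by case: l i => [[]|].
have il := ltn_ord i.
have card_part : #|residue_parts n i| = n %/ l + (i < n %% l).
  elim: n => [|n IHn].
    rewrite div0n mod0n ltn0; apply/eqP; rewrite cards_eq0.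
    by apply/eqP/setP => -[].
  have -> : #|residue_parts n.+1 i| = #|residue_parts n i| + (n %% l == i).
    rewrite -!sum1_card [LHS]big_mkcond [in RHS]big_mkcond /= big_ord_recr /=.
    congr (_ + _); last by rewrite inE /=; case: eqP.
    by apply: eq_bigr => x _; rewrite !inE.
  rewrite IHn divnS // modnS; have := ltn_pmod n l0.
  case: (boolP (l %| n.+1)) => [dv|_]; last by lia.
  have : (n %% l).+1 %% l = 0.
    by rewrite -addn1 modnDml addn1; apply/eqP.
  have [lt|ge] := ltnP (n %% l).+1 l; first by rewrite modn_small.
  by move=> _; lia.
rewrite card_part.
have -> : (n + l.-1) %/ l = n %/ l + (0 < n %% l).
  rewrite {1}(divn_eq n l) -addnA divnMDl //; congr (_ + _).
  have ml := ltn_pmod n l0; case: posnP => [->|m0].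
    by rewrite divn_small //; lia.
  have -> : n %% l + l.-1 = 1 * l + (n %% l).-1 by lia.
  by rewrite divnMDl // divn_small //; lia.
by case: ltnP; lia.
Qed.

(* Main.v *)
Require Import Defs.
From mathcomp Require Import all_boot all_order all_algebra.
From mathcomp Require Import reals.
From mathcomp Require Import zify ring lra.
Import Order.TTheory GRing.Theory Num.Theory.
Set Implicit Arguments.
Unset Strict Implicit.
Unset Printing Implicit Defensive.

(** Everything happens in the shadow [H] of [G], the graph of the pairs covered
    by an edge. Choosing one edge through each pair of a clique shows that [H]
    has no clique on [l + 1] vertices ([shadow_free]), and the edges of [G] are
    [r]-cliques of [H]. Write [n] for the number of vertices and [k_s] for the
    number of [s]-cliques of [H].

    Many [r]-cliques force many graph edges. The Moon-Moser inequality
    ([moon_moser]), used downwards from [k_(l+1) = 0], bounds each ratio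
    [k_(s+1) / k_s] by its value [(l - s) n / ((s + 1) l)] in the balanced
    complete [l]-partite graph ([clique_ratio]). Multiplying these bounds makes
    [k_r] at most linear in [k_2], with equality in that graph
    ([clique_chain]); hence a proportion [1 - epsilon] of the [r]-cliques gives,
    up to a lower order term, a proportion [1 - epsilon] of the graph edges.

    Many graph edges force stability. Fueredi's greedy argument: cut off the
    non-neighbours of a vertex of maximum degree as one class and go on inside
    its neighbourhood, which has a smaller clique number. This gives a partition
    into [l] classes whose number of inner graph edges is at most the deficit
    in [k_2] ([greedy_coloring], [monochromatic_bound]).

    An edge of [G] that is not transversal contains an inner pair of [H], and a
    pair lies in at most ['C(n, r - 2)], so at most [n ^ (r - 2) / (r - 2)!],
    edges ([bad_edges_bound]). This is where the factor [(r - 2)!] in [epsilon]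
    comes from. *)

(** * Cliques and the Moon-Moser inequality *)

Lemma sqr_sum_le (I : finType) (A : {pred I}) (a : I -> nat) :
  (\sum_(i in A) a i) ^ 2 <= #|A| * \sum_(i in A) a i ^ 2.
Proof.
rewrite -(leq_pmul2l (isT : 0 < 2)).
have -> : 2 * (#|A| * \sum_(i in A) a i ^ 2) =
    \sum_(i in A) \sum_(j in A) (a i ^ 2 + a j ^ 2).
  under [RHS]eq_bigr do rewrite big_split /= sum_nat_const.
  by rewrite big_split /= -big_distrr /= sum_nat_const; lia.
rewrite -mulnn big_distrlr /= big_distrr leq_sum //= => i _.
rewrite big_distrr leq_sum //= => j _.
exact: nat_Cauchy.
Qed.

Definition clique (T : finType) (H : rel T) (K : {set T}) : bool :=
  [forall x in K, forall y in K, (x != y) ==> H x y].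

Lemma cliqueP (T : finType) (H : rel T) (K : {set T}) :
  reflect {in K &, forall x y, x != y -> H x y} (clique H K).
Proof.
apply: (iffP forall_inP) => [h x y xK yK | h x xK].
  by move/forall_inP: (h _ xK) => /(_ _ yK) /implyP.
by apply/forall_inP => y yK; apply/implyP; apply: h.
Qed.

Lemma clique_sub (T : finType) (H : rel T) (K L : {set T}) :
  K \subset L -> clique H L -> clique H K.
Proof. by move=> /subsetP s /cliqueP h; apply/cliqueP; apply: sub_in2 h. Qed.

Lemma cliqueU1 (T : finType) (H : rel T) (K : {set T}) (x : T) :
  symmetric H -> clique H K -> {in K, forall z, x != z -> H x z} ->
  clique H (x |: K).
Proof.
move=> symH /cliqueP cK xK; apply/cliqueP => y z.
rewrite !in_setU1 => /predU1P[->|yK] /predU1P[->|zK].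
- by rewrite eqxx.
- exact: xK.
- by rewrite symH eq_sym; apply: xK.
- exact: cK.
Qed.

Definition cliques (T : finType) (H : rel T) (s : nat) : {set {set T}} :=
  [set K : {set T} | (#|K| == s) && clique H K].

Definition extends (T : finType) (H : rel T) (B : {set T}) (x : T) : bool :=
  (x \notin B) && clique H (x |: B).

Definition codegree (T : finType) (H : rel T) (B : {set T}) : nat :=
  #|[set x | extends H B x]|.

(** Double counting of the pairs formed by an [s]-clique [B] and a vertex
    extending it: such a pair is also an [s.+1]-clique with a marked vertex. *)
Lemma sum_extensions (T : finType) (H : rel T) (s : nat) (F : {set T} -> nat) :
  \sum_(B in cliques H s) codegree H B * F B =
  \sum_(A in cliques H s.+1) \sum_(x in A) F (A :\ x).
Proof.
under eq_bigr do rewrite -sum_nat_cond_const.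
rewrite !pair_big_dep /=.
rewrite (reindex_onto (fun p => (p.1 :\ p.2, p.2))
  (fun p => (p.2 |: p.1, p.2))) /=; last first.
  by case=> B x /= /andP[_ /andP[xB _]]; rewrite setU1K.
apply: eq_bigl => -[A x] /=; rewrite !inE xpair_eqE eqxx andbT /extends setD11 /=.
apply/idP/idP.
  case/andP=> /andP[/andP[/eqP sA _] cA] /eqP eA.
  have xA : x \in A by rewrite -eA setU11.
  by rewrite -[clique H A](congr1 (clique H) eA) cA xA (cardsD1 x) xA sA !andbT.
case/andP=> /andP[sA cA] xA.
rewrite setD1K // eqxx cA (clique_sub (subsetDl _ _) cA) !andbT.
by move: sA; rewrite (cardsD1 x) xA add1n eqSS.
Qed.

Lemma sum_codegree (T : finType) (H : rel T) (s : nat) :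
  \sum_(B in cliques H s) codegree H B = s.+1 * #|cliques H s.+1|.
Proof.
have := sum_extensions H s (fun=> 1).
under eq_bigr do rewrite muln1.
move=> ->; rewrite mulnC -sum_nat_const; apply: eq_bigr => A.
by rewrite inE => /andP[/eqP <- _]; rewrite sum1_card.
Qed.

(** A vertex [y] that extends two distinct facets [A :\ x] of the clique [A] is
    adjacent to all of [A], and so extends [A] itself. Hence [y] extends at most
    one facet, unless it extends [A], in which case it extends all [s.+1] of
    them. *)
Lemma sum_codegree_facets (T : finType) (H : rel T) (s : nat) (A : {set T}) :
  symmetric H -> A \in cliques H s.+1 ->
  \sum_(x in A) codegree H (A :\ x) <= #|T| + s * codegree H A.
Proof.
move=> symH; rewrite inE => /andP[/eqP sA /cliqueP cA].
have codegE B : codegree H B = \sum_y extends H B y.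
  by rewrite /codegree -sum1dep_card big_mkcond /=; apply: eq_bigr => y _; case: ifP.
under eq_bigr do rewrite codegE.
rewrite exchange_big codegE big_distrr /= -sum1_card -big_split /= leq_sum // => y _.
have [ext|next] := boolP (extends H A y).
  by rewrite muln1 add1n -sA -sum1_card leq_sum // => x _; apply: leq_b1.
have [/exists_inP[x0 x0A ext0]|] := boolP [exists x in A, extends H (A :\ x) y];
  last first.
  move=> /exists_inPn none; rewrite big1 // => x xA.
  by rewrite (negbTE (none x xA)).
rewrite (bigD1 x0) //= ext0 muln0 addn0 big1 // => x /andP[xA xx0].
apply/eqP; rewrite eqb0; apply: contraNN next => ext1.
case/andP: ext0 ext1; rewrite !inE negb_and negbK => y0 /cliqueP c0.
case/andP; rewrite !inE negb_and negbK => y1 /cliqueP c1.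
have yA : y \notin A.
  apply/negP => yA; move: y0 y1 xx0; rewrite yA !orbF => /eqP <- /eqP <-.
  by rewrite eqxx.
rewrite /extends yA; apply: cliqueU1 => //; first exact/cliqueP.
move=> z zA yz; have [zx|zx] := eqVneq z x.
  by apply: c0 => //; rewrite !inE ?eqxx // zA zx xx0 orbT.
by apply: c1 => //; rewrite !inE ?eqxx // zA zx orbT.
Qed.

(** Cauchy-Schwarz for the codegrees of the [s]-cliques, whose squares are
    summed by counting each [s.+1]-clique [A] with its facets. *)
Lemma moon_moser (T : finType) (H : rel T) (s : nat) :
  symmetric H ->
  (s.+1 * #|cliques H s.+1|) ^ 2 <=
  #|cliques H s| *
    (#|T| * #|cliques H s.+1| + s * (s.+2 * #|cliques H s.+2|)).
Proof.
move=> symH; rewrite -sum_codegree.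
apply: leq_trans (sqr_sum_le _ _) _; rewrite leq_mul2l; apply/orP; right.
under eq_bigr do rewrite -mulnn.
rewrite sum_extensions.
apply: (@leq_trans (\sum_(A in cliques H s.+1) (#|T| + s * codegree H A))).
  by apply: leq_sum => A; apply: sum_codegree_facets.
by rewrite big_split /= sum_nat_const -big_distrr /= sum_codegree mulnC.
Qed.

(** Downward induction on [s]: given the bound for [s.+1], the Moon-Moser
    inequality yields the one for [s] after division by [#|cliques H s.+1|]. *)
Lemma clique_ratio (T : finType) (H : rel T) (l s : nat) :
  symmetric H -> cliques H l.+1 = set0 -> s <= l ->
  l * (s.+1 * #|cliques H s.+1|) <= #|T| * ((l - s) * #|cliques H s|).
Proof.
move=> symH free sl.
move em: (l - s) => m; elim: m s sl em => [|m IHm] s sl em.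
  have -> : s = l by lia.
  by rewrite free cards0 !muln0.
have := IHm s.+1 ltac:(lia) ltac:(lia).
have := moon_moser s symH.
have -> : l = m + s.+1 by lia.
move: #|cliques H s| #|cliques H s.+1| #|cliques H s.+2| #|T| => k k1 k2 n MM IH.
(* Both sides are multiplied by [s.+1 * k1]; the goal then is the sum of MM,
   scaled by [l], and IH, scaled by [k * s]. *)
case: (posnP k1) => [->|k1_gt0]; first by rewrite !muln0.
rewrite -(@leq_pmul2l (s.+1 * k1)) ?muln_gt0 //.
have := leq_mul (leqnn (m + s.+1)) MM.
have := leq_mul (leqnn (k * s)) IH.
rewrite -mulnn.
have -> : k * s * (n * (m * k1)) = n * k * k1 * (s * m) by ring.
have -> : k * s * ((m + s.+1) * (s.+2 * k2)) =
  (m + s.+1) * (k * (s * (s.+2 * k2))) by ring.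
have -> : (m + s.+1) * (k * (n * k1 + s * (s.+2 * k2))) =
  n * k * k1 * (m + s.+1) + (m + s.+1) * (k * (s * (s.+2 * k2))) by ring.
have -> : s.+1 * k1 * (n * (m.+1 * k)) =
  n * k * k1 * (m + s.+1) + n * k * k1 * (s * m) by ring.
have -> : s.+1 * k1 * ((m + s.+1) * (s.+1 * k1)) =
  (m + s.+1) * (s.+1 * k1 * (s.+1 * k1)) by ring.
lia.
Qed.

(** The product of the bounds of [clique_ratio] for the sizes [2] to [s.+1]. *)
Lemma clique_chain (T : finType) (H : rel T) (l s : nat) :
  symmetric H -> cliques H l.+1 = set0 -> s.+2 <= l ->
  #|cliques H s.+2| * ('C(l, 2) * l ^ s) <=
  #|cliques H 2| * (#|T| ^ s * 'C(l, s.+2)).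
Proof.
move=> symH free; elim: s => [|s IHs] sl; first by rewrite !expn0 mul1n muln1.
rewrite !expnS -(@leq_pmul2l s.+3) //.
have := clique_ratio symH free (ltnW sl).
have := IHs (ltnW sl).
have := mul_bin_left l s.+2.
move: #|cliques H s.+2| #|cliques H s.+3| #|cliques H 2| #|T| ('C(l, 2)) =>
  k k1 k2 n c.
move=> eC Hk Hk1.
have -> : s.+3 * (k2 * (n * n ^ s * 'C(l, s.+3))) =
  k2 * n * n ^ s * (s.+3 * 'C(l, s.+3)) by ring.
rewrite eC.
have := leq_mul (leqnn (n * (l - s.+2))) Hk.
have := leq_mul (leqnn (c * l ^ s)) Hk1.
have -> : c * l ^ s * (l * (s.+3 * k1)) = s.+3 * (k1 * (c * (l * l ^ s))) by ring.
have -> : c * l ^ s * (n * ((l - s.+2) * k)) =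
  n * (l - s.+2) * (k * (c * l ^ s)) by ring.
have -> : n * (l - s.+2) * (k2 * (n ^ s * 'C(l, s.+2))) =
  k2 * n * n ^ s * ((l - s.+2) * 'C(l, s.+2)) by ring.
exact: leq_trans.
Qed.

(** * The number of edges of the Turan hypergraph *)

(** The [s]-sets transversal to the residue classes are the [s]-cliques of a
    complete [l]-partite graph. Each of them misses [l - s] classes, hence has
    codegree at least [(l - s) * (n %/ l)], and the bound follows by induction
    on [r]. *)
Lemma turan_lower (r n l : nat) : 0 < l ->
  'C(l, r) * (n %/ l) ^ r <= turan_number r n l.
Proof.
move=> l_gt0.
pose H : rel 'I_n := fun x y => x %% l != y %% l.
pose class (x : 'I_n) : 'I_l := Ordinal (ltn_pmod x l_gt0).
have symH : symmetric H by move=> x y; rewrite /H /= eq_sym.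
have TE s : cliques H s = edges (turan_graph s n l).
  apply/setP => K; rewrite !inE; congr (_ && _); apply/cliqueP/forallP.
    move=> cK i; apply/card_le1_eqP => x y; rewrite !inE.
    move=> /andP[xK /eqP xi] /andP[yK /eqP yi]; apply/eqP/negPn/negP.
    by move=> /(cK _ _ yK xK); rewrite /H /= xi yi eqxx.
  move=> tK x y xK yK xy; apply/negP => /eqP exy.
  have /card_le1_eqP := tK (class x).
  move=> /(_ x y); rewrite !inE /= xK yK exy eqxx => /(_ isT isT) e.
  by rewrite e eqxx in xy.
rewrite /turan_number -TE; elim: r => [|r IHr].
  rewrite bin0 expn0 mul1n card_gt0; apply/set0Pn; exists set0.
  by rewrite inE cards0 eqxx; apply/cliqueP => x y; rewrite inE.
rewrite -(@leq_pmul2l r.+1) // -sum_codegree mulnA mul_bin_left.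
apply: (@leq_trans (\sum_(B in cliques H r) (l - r) * (n %/ l))); last first.
  apply: leq_sum => B; rewrite inE => /andP[/eqP sB cB].
  pose J := ~: (class @: B).
  apply: (@leq_trans #|[set x | class x \in J]|); last first.
    apply/subset_leq_card/subsetP => x; rewrite !inE => xJ.
    have new y : y \in B -> x %% l != y %% l.
      by move=> yB; apply: contraNN xJ => /eqP e; apply/imsetP; exists y => //;
        apply: val_inj.
    apply/andP; split; last by apply: cliqueU1 => // y /new.
    by apply/negP => /new; rewrite eqxx.
  apply: (@leq_trans (\sum_(i in J) n %/ l)).
    rewrite sum_nat_const leq_mul2r cardsCs setCK card_ord.
    by rewrite leq_sub2l ?orbT // -sB leq_imset_card.
  rewrite -sum1_card (partition_big class (mem J)) /=; last by move=> x; rewrite inE.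
  apply: leq_sum => i iJ.
  have -> : \sum_(x in [set x | class x \in J] | class x == i) 1 =
      #|residue_parts n i|.
    rewrite -sum1_card; apply: eq_bigl => x; rewrite !inE -val_eqE /=.
    apply: andb_idl => /eqP xi; move: iJ; rewrite inE.
    by have -> : class x = i by exact: val_inj.
  case: (residue_parts_balanced n i) => -> //.
  by apply: leq_div2r; exact: leq_addr.
rewrite sum_nat_const expnS.
have := leq_mul IHr (leqnn ((l - r) * (n %/ l))); apply: leq_trans.
by apply: eq_leq; ring.
Qed.

(** * Partitions with few inner edges *)

(** Induction on [l], inside the neighbourhood [N] of a vertex of maximum degree
    in [A]; the class [A :\: N] gets the new colour. The bound says that the
    ordered adjacent pairs, plus the monochromatic adjacent pairs, plus all
    monochromatic pairs number at most [#|A| ^ 2]. Passing from [N] to [A] adds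
    twice the sum of the degrees in [A] over [A :\: N], which is at most
    [2 * #|A :\: N| * #|N|] by the choice of [N], and the [#|A :\: N| ^ 2] pairs
    of the new class. *)
Lemma greedy_coloring (T : finType) (H : rel T) (l : nat) (A : {set T}) :
  symmetric H -> irreflexive H ->
  (forall K : {set T}, K \subset A -> clique H K -> #|K| <= l) ->
  exists2 c : T -> nat, {in A, forall x, c x < l} &
    \sum_(x in A) \sum_(y in A) (H x y + (c x == c y) * (H x y).+1) <= #|A| ^ 2.
Proof.
move=> symH irrH; elim: l A => [|l IHl] A free.
  have -> : A = set0.
    apply/setP => x; rewrite inE; apply/negP => xA.
    have cx : clique H [set x].
      by apply/cliqueP => y z; rewrite !inE => /eqP -> /eqP ->; rewrite eqxx.
    by have := free [set x]; rewrite sub1set xA cards1 cx => /(_ isT isT).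
  by exists (fun=> 0) => [x|]; rewrite ?inE // big_set0.
have [->|[a aA]] := set_0Vmem A.
  by exists (fun=> 0) => [x|]; rewrite ?inE // big_set0.
pose deg x := \sum_(y in A) H x y.
case: (arg_maxnP (P := fun z => z \in A) deg aA) => x xA max_x.
pose N := [set y in A | H x y].
have NA : N \subset A by apply/subsetP => y; rewrite inE => /andP[].
have degx : deg x = #|N|.
  rewrite /deg -sum1_card big_mkcond [RHS]big_mkcond; apply: eq_bigr => y _ /=.
  by rewrite inE; case: (y \in A); case: (H x y).
case: (IHl N) => [K KN cK|c cl cN].
  have xK : x \notin K.
    by apply/negP => /(subsetP KN); rewrite inE irrH andbF.
  have := free (x |: K); rewrite cardsU1 xK add1n ltnS; apply.
    by rewrite subUset sub1set xA (subset_trans KN NA).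
  by apply: cliqueU1 => // z /(subsetP KN); rewrite inE => /andP[].
pose c' y := if y \in N then c y else l.
exists c' => [y _ |]; first by rewrite /c'; case: ifP => [/cl|_]; lia.
have split_sum (F : T -> nat) :
  \sum_(y in A) F y = \sum_(y in N) F y + \sum_(y in A :\: N) F y.
  by rewrite (big_setID N) /= (setIidPr NA).
have outer : \sum_(y in A :\: N) deg y <= #|A :\: N| * #|N|.
  by rewrite -sum_nat_const -degx leq_sum // => y /setDP[/max_x].
have cross : \sum_(y in N) \sum_(z in A :\: N) H y z =
    \sum_(y in A :\: N) \sum_(z in N) H y z.
  rewrite exchange_big; apply: eq_bigr => y _; apply: eq_bigr => z _.
  by rewrite symH.
pose f y z := H y z + (c' y == c' z) * (H y z).+1.
rewrite -[X in X <= _]/(\sum_(y in A) \sum_(z in A) f y z).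
have fNN : \sum_(y in N) \sum_(z in N) f y z <= #|N| ^ 2.
  apply: leq_trans cN; apply: eq_leq; apply: eq_bigr => y yN.
  by apply: eq_bigr => z zN; rewrite /f /c' yN zN.
have fNM : \sum_(y in N) \sum_(z in A :\: N) f y z =
    \sum_(y in A :\: N) \sum_(z in N) H y z.
  rewrite -cross; apply: eq_bigr => y yN; apply: eq_bigr => z /setDP[_ /negbTE zN].
  by rewrite /f /c' yN zN (ltn_eqF (cl y yN)) addn0.
have fMN : \sum_(y in A :\: N) \sum_(z in N) f y z =
    \sum_(y in A :\: N) \sum_(z in N) H y z.
  apply: eq_bigr => y /setDP[_ /negbTE yN]; apply: eq_bigr => z zN.
  by rewrite /f /c' yN zN eq_sym (ltn_eqF (cl z zN)) addn0.
have fMM : \sum_(y in A :\: N) \sum_(z in A :\: N) f y z =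
    2 * (\sum_(y in A :\: N) \sum_(z in A :\: N) H y z) + #|A :\: N| ^ 2.
  rewrite -mulnn -[X in _ + X]sum_nat_const big_distrr -big_split /=.
  apply: eq_bigr => y /setDP[_ /negbTE yN].
  rewrite -[#|_|]sum1_card big_distrr -big_split /=.
  apply: eq_bigr => z /setDP[_ /negbTE zN].
  by rewrite /f /c' yN zN eqxx; lia.
move: outer; rewrite /deg.
under eq_bigr do rewrite split_sum.
rewrite big_split /= => outer.
rewrite split_sum.
under eq_bigr do rewrite split_sum.
under [X in _ + X <= _]eq_bigr do rewrite split_sum.
rewrite !big_split /= fNM fMN fMM.
have -> : #|A| = #|N| + #|A :\: N| by rewrite -(cardsID N A) (setIidPr NA).
by rewrite sqrnD; lia.
Qed.

Lemma cliques_eq0_mono (T : finType) (H : rel T) (s m : nat) :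
  cliques H s = set0 -> s <= m -> cliques H m = set0.
Proof.
move=> s0 /subnK <-; elim: (m - s) => [//|d IHd].
have := sum_codegree H (d + s); rewrite IHd big_set0 => /esym/eqP.
by rewrite muln_eq0 /= cards_eq0 => /eqP.
Qed.

Lemma handshake (T : finType) (H : rel T) :
  symmetric H -> irreflexive H ->
  \sum_x \sum_y H x y = 2 * #|cliques H 2|.
Proof.
move=> symH irrH; rewrite -sum_codegree.
have -> : cliques H 1 = [set [set x] | x in T].
  apply/setP => K; rewrite inE; apply/andP/imsetP.
    by case=> /cards1P[x ->] _; exists x.
  case=> x _ ->; rewrite cards1; split=> //.
  by apply/cliqueP => y z; rewrite !inE => /eqP -> /eqP ->; rewrite eqxx.
rewrite big_imset /=; last by move=> x y _ _; apply: set1_inj.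
apply: eq_big => // x _; rewrite /codegree -sum1dep_card [RHS]big_mkcond /=.
apply: eq_bigr => y _; rewrite /extends inE.
have [->|yx] := eqVneq y x; first by rewrite irrH.
suff -> : clique H (y |: [set x]) = H x y by case: (H x y).
apply/cliqueP/idP => [cyx|xy].
  by apply: cyx; rewrite ?inE ?eqxx ?orbT // eq_sym.
move=> z t; rewrite !inE => /orP[]/eqP -> /orP[]/eqP ->; rewrite ?eqxx //.
by rewrite symH.
Qed.

(** Cauchy-Schwarz for the sizes of the colour classes: the double sum counts
    the monochromatic ordered pairs. *)
Lemma card_sqr_le_colored (T : finType) (l : nat) (c : T -> nat) :
  (forall x, c x < l) -> #|T| ^ 2 <= l * \sum_x \sum_y (c x == c y).
Proof.
move=> cl; pose c' x : 'I_l := Ordinal (cl x).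
pose V i := [set x | c' x == i].
have -> : #|T| = \sum_(i < l) #|V i|.
  rewrite -sum1_card (partition_big c' predT) //=; apply: eq_bigr => i _.
  by rewrite -sum1dep_card.
have -> : \sum_x \sum_y (c x == c y) = \sum_(i < l) #|V i| ^ 2.
  rewrite (partition_big c' predT) //=; apply: eq_bigr => i _.
  rewrite -mulnn -sum_nat_const; apply: eq_big => [x|x /eqP <-].
    by rewrite inE.
  rewrite /V -sum1dep_card [RHS]big_mkcond /=; apply: eq_bigr => y _.
  by rewrite -val_eqE /= eq_sym; case: eqP.
by have := sqr_sum_le 'I_l (fun i => #|V i|); rewrite card_ord.
Qed.

(** In other words, the ordered adjacent pairs and the monochromatic ones
    together number at most [(1 - 1 / l) * #|T| ^ 2]. *)
Lemma monochromatic_bound (T : finType) (H : rel T) (l : nat) :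
  symmetric H -> irreflexive H -> cliques H l.+1 = set0 ->
  exists2 c : T -> nat, forall x, c x < l &
    l * (2 * #|cliques H 2| + \sum_x \sum_y (c x == c y) * H x y) + #|T| ^ 2
      <= l * #|T| ^ 2.
Proof.
move=> symH irrH free.
have [|c cl cH] := @greedy_coloring T H l [set: T] symH irrH.
  move=> K _ cK; rewrite leqNgt; apply/negP => lK.
  have : K \in cliques H #|K| by rewrite inE eqxx.
  by rewrite (cliques_eq0_mono free lK) inE.
have {}cl x : c x < l by apply: cl.
exists c => //.
rewrite -handshake //.
apply: (leq_trans (leq_add (leqnn _) (card_sqr_le_colored cl))).
rewrite -mulnDr leq_mul2l; apply/orP; right.
move: cH; rewrite cardsT; apply: leq_trans; apply: eq_leq.
rewrite -!big_split /=; apply: eq_big => [x|x _]; first by rewrite inE.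
rewrite -!big_split /=; apply: eq_big => [y|y _]; first by rewrite inE.
by rewrite mulnS; lia.
Qed.

(** * The shadow of a hypergraph *)

Definition shadow (r : nat) (T : finType) (G : hgraph r T) : rel T :=
  fun x y => (x != y) && [exists e in edges G, (x \in e) && (y \in e)].

Lemma shadow_sym (r : nat) (T : finType) (G : hgraph r T) : symmetric (shadow G).
Proof.
move=> x y; rewrite /shadow eq_sym; congr (_ && _).
by apply: eq_existsb => e; rewrite [(x \in e) && _]andbC.
Qed.

Lemma shadow_irr (r : nat) (T : finType) (G : hgraph r T) : irreflexive (shadow G).
Proof. by move=> x; rewrite /shadow eqxx. Qed.

Lemma edge_shadow (r : nat) (T : finType) (G : hgraph r T) (e : {set T}) :
  e \in edges G -> {in e &, forall x y, x != y -> shadow G x y}.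
Proof.
move=> eG x y xe ye xy; rewrite /shadow xy; apply/exists_inP.
by exists e; rewrite ?xe.
Qed.

Lemma edges_sub_cliques (r : nat) (T : finType) (G : hgraph r T) :
  edges G \subset cliques (shadow G) r.
Proof.
apply/subsetP => e eG; rewrite inE (edges_uniform eG) eqxx.
by apply/cliqueP; apply: edge_shadow.
Qed.

(** Given a [k]-clique of the shadow, choose an edge of [G] through each of its
    pairs: the chosen edges form a member of the family inside [G]. *)
Lemma shadow_free (r k : nat) (T : finType) (G : hgraph r T) :
  family_free (Kfamily r k) G -> cliques (shadow G) k = set0.
Proof.
move=> free; apply/eqP; apply/negPn/negP => /set0Pn[S].
rewrite inE => /andP[/eqP sS /cliqueP cS].
pose pairs := [set P : {set T} | P \subset S & #|P| == 2].
pose cover_edge (P : {set T}) := odflt set0 [pick e in edges G | P \subset e].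
have coverP x y : x \in S -> y \in S -> x != y ->
    cover_edge [set x; y] \in edges G /\ [set x; y] \subset cover_edge [set x; y].
  move=> xS yS xy; rewrite /cover_edge.
  case: pickP => [e /andP[]//|none].
  case/andP: (cS x y xS yS xy) => _ /exists_inP[e eG /andP[xe ye]].
  by have := none e; rewrite eG subUset !sub1set xe ye.
have unif e : e \in [set cover_edge P | P in pairs] -> #|e| = r.
  case/imsetP => P; rewrite inE => /andP[PS /cards2P[x [y [xy eP]]]] ->.
  move: PS; rewrite eP subUset !sub1set => /andP[xS yS] {eP}.
  by apply: (@edges_uniform _ _ G); case: (coverP x y xS yS xy).
apply: (free T (HGraph unif)).
  split; first by rewrite /= (leq_trans (leq_imset_card _ _)) // cards_draws sS.
  exists S => // x y xS yS xy; have [_] := coverP x y xS yS xy.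
  rewrite subUset !sub1set => xye; exists (cover_edge [set x; y]) => //.
  apply/imsetP; exists [set x; y] => //.
  by rewrite inE subUset !sub1set xS yS cards2 xy.
exists id => // e /imsetP[P]; rewrite inE => /andP[PS /cards2P[x [y [xy eP]]]] ->.
move: PS; rewrite eP subUset !sub1set imset_id => /andP[xS yS].
by case: (coverP x y xS yS xy).
Qed.

(** Removing [x] and [y] maps these edges injectively to [(r - 2)]-sets. *)
Lemma edges_through_pair (r : nat) (T : finType) (G : hgraph r T) (x y : T) :
  x != y ->
  #|[set e in edges G | (x \in e) && (y \in e)]| <= 'C(#|T|, r - 2).
Proof.
move=> xy; rewrite -[#|T|]cardsT -cards_draws.
set E := [set e in _ | _].
have inj : {in E &, injective (fun e : {set T} => e :\ x :\ y)}.
  move=> e f; rewrite !inE => /andP[_ /andP[xe ye]] /andP[_ /andP[xf yf]] ef.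
  rewrite -(setD1K xe) -(setD1K xf); congr (_ |: _).
  have yex : y \in e :\ x by rewrite !inE eq_sym xy.
  have yfx : y \in f :\ x by rewrite !inE eq_sym xy.
  by rewrite -(setD1K yex) -(setD1K yfx) ef.
rewrite -(card_in_imset inj); apply/subset_leq_card/subsetP => _ /imsetP[e eE ->].
move: eE; rewrite !inE subsetT => /andP[eG /andP[xe ye]] /=.
have := edges_uniform eG; rewrite (cardsD1 x) xe (cardsD1 y) !inE eq_sym xy ye => <-.
by apply/eqP; lia.
Qed.

(** An edge with two vertices in the same class contains a monochromatic pair of
    the shadow; sum over these pairs. *)
Lemma bad_edges_bound (r l : nat) (T : finType) (G : hgraph r T) (c : T -> nat) :
  #|[set e in edges G | ~~ transversal_edge (fun i : 'I_l => [set x | c x == i]) e]|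
  <= (\sum_x \sum_y (c x == c y) * shadow G x y) * 'C(#|T|, r - 2).
Proof.
set V := fun i : 'I_l => _.
apply: (@leq_trans (\sum_(e in edges G) \sum_x \sum_y
    ((c x == c y) * shadow G x y * ((x \in e) && (y \in e))))).
  rewrite -sum1dep_card big_mkcondr /=; apply: leq_sum => e eG.
  case: ifP => // /forallPn[i]; rewrite -ltnNge => /card_gt1P[x [y [xe ye xy]]].
  move: xe ye; rewrite !inE => /andP[xe /eqP xi] /andP[ye /eqP yi].
  rewrite (bigD1 x) //= (bigD1 y) //= xi yi eqxx xe ye (edge_shadow eG) //.
rewrite exchange_big /= big_distrl leq_sum //= => x _.
rewrite exchange_big /= big_distrl leq_sum //= => y _.
rewrite -big_distrr leq_mul2l /=; apply/orP.
have [xy|] := boolP (shadow G x y); last by rewrite muln0; left.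
right; apply: leq_trans (edges_through_pair G (proj1 (andP xy))).
by rewrite -sum1dep_card big_mkcondr /=; apply: leq_sum => e _; case: ifP.
Qed.

(** * From counts to the asymptotic bound *)

Lemma ffact_le_exp (n m : nat) : n ^_ m <= n ^ m.
Proof.
by elim: m => [//|m IHm]; rewrite ffactnSr expnSr leq_mul ?leq_subr.
Qed.

(** Bernoulli's inequality; it compares [n] with [l * (n %/ l)]. *)
Lemma expn_sub_le (a b k : nat) :
  b <= a -> a ^ k <= b ^ k + k * (a - b) * a ^ k.-1.
Proof.
move=> ba; elim: k => [//|k IHk].
rewrite /= !expnS.
have eb : b ^ k <= a ^ k by case: k {IHk} => // k; rewrite leq_exp2r.
have ek : k * (a - b) * a ^ k.-1 * a = k * (a - b) * a ^ k.
  by case: k {IHk eb} => [|k] //=; rewrite expnSr; ring.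
have := leq_mul IHk (leqnn a); rewrite mulnDl ek.
have := leq_mul eb (leqnn (a - b)).
have -> : b ^ k * a = b * b ^ k + b ^ k * (a - b) by rewrite -{1}(subnKC ba); ring.
by lia.
Qed.

Local Open Scope ring_scope.

(** Here [q] stands for [n %/ l], [W] for the number of ordered monochromatic
    adjacent pairs of the shadow and [k2] for its number of edges. The trivial
    bound [W <= n ^ 2] settles the case [1 <= eps]. Otherwise, up to the rounding
    error of [q], the last two hypotheses give
    [l * W <= (l - 1) * eps * n ^ 2], and the room of [eps * n ^ 2] between this
    and the goal, multiplied by [l], absorbs that error as soon as [n] is at
    least [l ^ 2 * s.+2 / eps]. *)
Lemma stability_arith (R : realFieldType) (l s n q W k2 : nat) (eps : R) :
  (0 < l)%N -> 0 < eps -> (l ^ 2 * s.+2)%N%:R <= eps * n%:R ->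
  (l * q <= n <= l * q + l)%N ->
  (l * (2 * k2 + W) + n ^ 2 <= l * n ^ 2)%N ->
  (1 - eps) * (l.-1 * (l * q) ^ s.+2)%N%:R <= (2 * l * k2 * n ^ s)%N%:R ->
  (W * n ^ s)%N%:R <= eps * n%:R ^+ s.+2.
Proof.
move=> l0 eps0 nbig /andP[qn nq] edgesW k2_ge.
have l0R : 0 < l%:R :> R by rewrite ltr0n.
have -> : n%:R ^+ s.+2 = (n ^ 2 * n ^ s)%N%:R :> R by rewrite -natrX -expnD.
have Wn : (W <= n ^ 2)%N by rewrite -(leq_pmul2l l0); lia.
have [eps1|eps1] := leP 1 eps.
  apply: (@le_trans _ _ (n ^ 2 * n ^ s)%N%:R).
    by rewrite ler_nat leq_mul2r Wn orbT.
  by rewrite ler_peMl.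
have pow := expn_sub_le s.+2 qn.
have {}pow : (n ^ 2 * n ^ s <= (l * q) ^ s.+2 + s.+2 * l * (n * n ^ s))%N.
  rewrite -expnD -expnS; apply: (leq_trans pow); rewrite leq_add2l.
  by rewrite leq_mul2r leq_mul2l; apply/orP; right; lia.
have {}edgesW : (l * W * n ^ s + 2 * l * k2 * n ^ s <= l.-1 * (n ^ 2 * n ^ s))%N.
  have := leq_mul edgesW (leqnn (n ^ s)).
  have -> : (l * n ^ 2 * n ^ s = l.-1 * (n ^ 2 * n ^ s) + n ^ 2 * n ^ s)%N.
    by rewrite -mulnA -{1}(prednK l0) mulSn addnC.
  have -> : ((l * (2 * k2 + W) + n ^ 2) * n ^ s =
    l * W * n ^ s + 2 * l * k2 * n ^ s + n ^ 2 * n ^ s)%N by ring.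
  by rewrite leq_add2r.
have lE : l%:R = l.-1%:R + 1 :> R by rewrite -{1}(prednK l0) -addn1 natrD.
rewrite -(ler_pM2l l0R) mulrA.
set X := (n ^ 2 * n ^ s)%N in pow edgesW *.
set P := ((l * q) ^ s.+2)%N in pow k2_ge *.
set Y := (n * n ^ s)%N in pow *.
have eqX : n%:R * Y%:R = X%:R :> R by rewrite -natrM /X /Y mulnA mulnn.
have Ybig : l%:R * (s.+2 * l * Y)%N%:R <= eps * X%:R.
  rewrite -eqX mulrA -natrM -[leRHS]mulrA mulrA.
  have -> : (l * (s.+2 * l * Y))%N = (l ^ 2 * s.+2 * Y)%N by ring.
  by rewrite natrM ler_wpM2r.
move: edgesW pow k2_ge.
rewrite -!(ler_nat R) !natrD -(mulnA l W) !(natrM _ l (W * _)) !(natrM _ l.-1).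
move: (W * n ^ s)%N%:R (2 * l * k2 * n ^ s)%N%:R P%:R X%:R Ybig {eqX}.
move: (s.+2 * l * Y)%N%:R (ler0n R (s.+2 * l * Y)) => y y0 w k p x ybig wk xp pk.
have L0 : 0 <= l.-1%:R :> R by [].
move: l.-1%:R l%:R lE L0 l0R => L l' lE L0 l0R in ybig wk pk *.
have : (1 - eps) * (L * (x - y)) <= (1 - eps) * (L * p).
  apply: ler_wpM2l; first by rewrite subr_ge0 ltW.
  by rewrite ler_wpM2l // lerBlDr.
have : (1 - eps) * (L * y) <= l' * y.
  rewrite mulrA ler_wpM2r // lE mulrBl mul1r; have := mulr_ge0 (ltW eps0) L0; lra.
rewrite lE in wk ybig *; lra.
Qed.

Theorem mainTheorem1 (R : realType) (r l : nat) (delta : R) :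
  (2 <= r)%N -> (r <= l)%N -> 0 < delta ->
  let epsilon := ((r - 2)`!)%:R * delta in
  exists n0 : nat, forall n : nat, (n0 <= n)%N ->
  forall (T : finType) (G : hgraph r T), #|T| = n ->
    family_free (Kfamily r l.+1) G ->
    (1 - epsilon) * (turan_number r n l)%:R <= #|edges G|%:R ->
    exists V : 'I_l -> {set T}, parts_of V /\
      #|[set e in edges G | ~~ transversal_edge V e]|%:R <= delta * n%:R ^+ r.
Proof.
move=> r2 rl delta0 eps.
have l0 : (0 < l)%N by lia.
have eps0 : 0 < eps by rewrite mulr_gt0 // ltr0n fact_gt0.
pose n0 := Num.bound ((l ^ 2 * r)%N%:R / eps).
exists n0 => n n0n T G cardT free many.
have symH := shadow_sym G; have irrH := shadow_irr G.
have freeH := shadow_free free.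
have [c cl edgesW] := monochromatic_bound symH irrH freeH.
exists (fun i : 'I_l => [set x | c x == i]); split.
  split.
    apply/setP => x; rewrite inE; apply/bigcupP.
    by exists (Ordinal (cl x)); rewrite ?inE.
  move=> i j; apply: contraNT => /pred0Pn[x]; rewrite /= !inE.
  by move=> /andP[/eqP xi /eqP xj]; apply/eqP/val_inj; rewrite /= -xi -xj.
have := bad_edges_bound l G c.
set bad := #|_|; set W := (\sum_x _)%N in edgesW * => badW.
have : (W * n ^ (r - 2))%N%:R <= eps * n%:R ^+ r.
  have rr : (r - 2).+2 = r by lia.
  rewrite -[X in _ ^+ X]rr.
  apply: (@stability_arith _ l _ _ (n %/ l) _ #|cliques (shadow G) 2|) => //.
  - rewrite rr mulrC -ler_pdivrMr //.
    apply: le_trans (ltW (archi_boundP _)) _; first by rewrite divr_ge0 // ltW.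
    by rewrite ler_nat.
  - by have := divn_eq n l; have := ltn_pmod n l0; lia.
  - by rewrite -cardT.
  (* If [1 <= eps], the left-hand side is nonpositive. *)
  rewrite rr; have [eps1|eps1] := leP 1 eps.
    by apply: (@le_trans _ _ 0); rewrite // mulr_le0_ge0 // subr_le0.
  have C0 : (0 < 'C(l, r))%N by rewrite bin_gt0.
  have := clique_chain (s := r - 2) symH freeH; rewrite rr cardT => /(_ rl) chain.
  have Gk := subset_leq_card (edges_sub_cliques G).
  have turan : (1 - eps) * ('C(l, r) * (n %/ l) ^ r)%N%:R
      <= #|cliques (shadow G) r|%:R.
    apply: (@le_trans _ _ ((1 - eps) * (turan_number r n l)%:R)).
      by rewrite ler_wpM2l ?subr_ge0 ?(ltW eps1) // ler_nat turan_lower.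
    by apply: le_trans many _; rewrite ler_nat.
  rewrite -(@ler_pM2r _ 'C(l, r)%:R) ?ltr0n // -mulrA -!natrM.
  have -> : (l.-1 * (l * (n %/ l)) ^ r * 'C(l, r) =
      'C(l, r) * (n %/ l) ^ r * (2 * l * ('C(l, 2) * l ^ (r - 2))))%N.
    have e2 : (2 * 'C(l, 2) = l.-1 * l)%N by rewrite mul_bin_left bin1 subn1.
    have -> : (2 * l * ('C(l, 2) * l ^ (r - 2)) =
      2 * 'C(l, 2) * (l * l ^ (r - 2)))%N by ring.
    have -> : (l * l ^ (r - 2) = l ^ r.-1)%N by rewrite -expnS -[in RHS]rr.
    rewrite e2 expnMn -[in LHS](prednK (ltnW r2)) expnS.
    by rewrite (prednK (ltnW r2)); ring.
  rewrite (natrM _ ('C(l, r) * (n %/ l) ^ r)) mulrA.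
  apply: (@le_trans _ _ (#|cliques (shadow G) r| *
    (2 * l * ('C(l, 2) * l ^ (r - 2))))%N%:R).
    by rewrite (natrM _ #|cliques (shadow G) r|) ler_wpM2r.
  rewrite ler_nat.
  have := leq_mul (leqnn (2 * l)%N) chain.
  set u := (_ * _)%N; set v := (_ * _)%N => uv.
  have -> : (#|cliques (shadow G) r| * (2 * l * ('C(l, 2) * l ^ (r - 2))) = u)%N.
    by rewrite /u; ring.
  by apply: leq_trans uv _; apply: eq_leq; rewrite /v; ring.
rewrite /eps -mulrA => main.
rewrite -(@ler_pM2l _ (r - 2)`!%:R) ?ltr0n ?fact_gt0 //; apply: le_trans main.
rewrite -natrM ler_nat mulnC.
apply: (@leq_trans (W * ('C(n, r - 2) * (r - 2)`!))).
  by rewrite mulnA leq_mul2r -cardT badW orbT.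
by rewrite leq_mul2l bin_ffact ffact_le_exp orbT.
Qed.
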